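(* Let $d\ge 1$ and let $(L_n)_n$ and $(b_n)_n$ be sequences of positive real numbers tending to infinity. For each $n$, let $C_n=[0,L_n]^d\subset\mathbb{R}^d$ be the $d$-dimensional cube equipped with the $\ell_\infty$-metric, with topological boundary $\partial C_n$, and let $A_n\subseteq C_n$ be a subset such that 1. $C_n\setminus A_n$ has more than one connected component; 2. there exist points $x_n,y_n\in C_n$ lying in different connected components of $C_n\setminus A_n$ such that $$d(x_n,A_n\cup\partial C_n)>b_n,\qquad d(y_n,A_n\cup\partial C_n)>b_n.$$ Let $\mathcal{A}=\{A_n\}_n$, each $A_n$ being equipped with the restricted metric. Then $\operatorname{asdim}(\mathcal{A})\ge d-1$.
   Context: **Asymptotic dimension of a family.** A collection $\mathcal{W}$ of subsets of a metric space is $r$-disjoint if $d(W,W')\ge r$ for any two distinct $W,W'\in\mathcal{W}$; it is $R$-bounded if all its members have diameter at most $R$. Let $\mathcal{X}$ be a family of metric spaces. A function $D_{\mathcal{X}}:\mathbb{R}_+\to\mathbb{R}_+$ is an $n$-dimensional control function for $\mathcal{X}$ if for every $r>0$ and every $X\in\mathcal{X}$, $X$ has a $D_{\mathcal{X}}(r)$-bounded cover $\mathcal{U}=\bigcup_{i=1}^{n+1}\mathcal{U}_i$ with each $\mathcal{U}_i$ $r$-disjoint. $\operatorname{asdim}(\mathcal{X})$ is the least integer $n$ such that $\mathcal{X}$ admits an $n$-dimensional control function ($\infty$ if there is none). *)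

(* Defs.v *)
From HB Require Import structures.
From mathcomp Require Import all_boot all_order all_algebra.
From mathcomp Require Import all_classical all_reals all_analysis.

Set Implicit Arguments.
Unset Strict Implicit.
Unset Printing Implicit Defensive.

Import Order.TTheory GRing.Theory Num.Theory.
Import numFieldNormedType.Exports.

Local Open Scope classical_set_scope.
Local Open Scope ring_scope.

(* The norm of the normed module ['M[R]_(m, n)] is the maximum of the absolute
   values of the entries, so that the following is the l_infinity metric on
   R^d, seen as ['rV[R]_d]. *)
Section linfty_metric.
Context {R : realType} {m n : nat}.

Let dist (x y : 'M[R]_(m, n)) : R := `|x - y|.

Let dist_ge0 x y : 0 <= dist x y.
Proof. exact: normr_ge0. Qed.

Let dist_positivity x y : dist x y = 0 -> x = y.
Proof. by move/normr0_eq0/eqP; rewrite subr_eq0 => /eqP. Qed.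

Let ballEdist x e : ball x e = [set y | dist x y < e].
Proof. by rewrite -ball_normE. Qed.

HB.instance Definition _ := @PseudoMetric_isMetric.Build R 'M[R]_(m, n)
  dist dist_ge0 dist_positivity ballEdist.

End linfty_metric.

Lemma mdist_rowE (R : realType) (d : nat) (x y : 'rV[R]_d) :
  mdist x y = \big[Num.max/0]_i `|x ord0 i - y ord0 i|.
Proof.
transitivity (mx_norm (x - y)) => //; rewrite mx_normrE.
apply/eqP; rewrite eq_le; apply/andP; split.
- apply/bigmax_leP; split; first exact: bigmax_ge_id.
  move=> [i j] _ /=; rewrite !mxE (ord1 i).
  exact: (le_bigmax_cond _ (fun i => `|x ord0 i - y ord0 i|)).
- apply/bigmax_leP; split; first exact: bigmax_ge_id.
  move=> j _; apply: (le_trans _ (le_bigmax_cond _ _ (j := (ord0, j)) _)) => //=.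
  by rewrite !mxE.
Qed.

(* The restricted metric on a subset [A] of a metric space, carried by the
   subtype [set_type A], whose pseudometric structure comes from the library. *)
Section restricted_metric.
Context {R : realType} {X : metricType R} (A : set X).

Let dist (x y : A) : R := mdist (set_val x) (set_val y).

Let dist_ge0 x y : 0 <= dist x y.
Proof. exact: mdist_ge0. Qed.

Let dist_positivity x y : dist x y = 0 -> x = y.
Proof. by move=> /mdist_positivity/val_inj. Qed.

Let ballEdist x e : ball x e = [set y | dist x y < e].
Proof.
by rewrite /ball/= /initial_ball /dist /= ballEmdist.
Qed.

HB.instance Definition _ := @PseudoMetric_isMetric.Build R (set_type A)
  dist dist_ge0 dist_positivity ballEdist.

End restricted_metric.

(* The library's [edist] and [edist_inf] are defined from balls; on a metric
   space [edist] is the distance. *)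
Lemma edist_mdist (R : realType) (X : metricType R) (x y : X) :
  edist (x, y) = (mdist x y)%:E.
Proof.
rewrite /edist /=; apply/eqP; rewrite eq_le; apply/andP; split.
- apply/lee_addgt0Pr => e e0; apply: ereal_inf_lbound.
  exists (mdist x y + e); last by rewrite EFinD.
  by split; rewrite ?ltr_wpDl ?mdist_ge0// ballEmdist /= ltrDl.
- apply: le_ereal_inf_tmp => _ [r [r0 +] <-].
  by rewrite ballEmdist /= lee_fin => /ltW.
Qed.

Section asymptotic_dimension.
Context {R : realType}.

Section metric_space.
Context {X : metricType R}.

Definition set_dist (V W : set X) : \bar R := ereal_inf (edist @` (V `*` W)).

(* The diameter of the empty set is [-oo]. *)
Definition diam (V : set X) : \bar R := ereal_sup (edist @` (V `*` V)).

Definition r_disjoint (r : R) (F : set (set X)) : Prop :=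
  forall V W, F V -> F W -> V <> W -> (r%:E <= set_dist V W)%E.

Definition r_bounded (r : R) (F : set (set X)) : Prop :=
  forall V, F V -> (diam V <= r%:E)%E.

End metric_space.

Definition control_function (I : Type) (X : I -> metricType R) (n : nat)
    (D : {nonneg R} -> {nonneg R}) : Prop :=
  forall r : {nonneg R}, 0 < r%:num -> forall i : I,
  exists U : 'I_n.+1 -> set (set (X i)),
    [/\ cover (\bigcup_k U k) id = setT,
        r_bounded (D r)%:num (\bigcup_k U k) &
        forall k, r_disjoint r%:num (U k)].

Definition has_control_function (I : Type) (X : I -> metricType R) (n : nat) :=
  exists D, control_function X n D.

Definition asdim (I : Type) (X : I -> metricType R) : \bar R :=
  if pselect (exists n, `[< has_control_function X n >]) is left ex_n
  then (ex_minn ex_n)%:R%:E else +oo%E.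

End asymptotic_dimension.

Definition boundary (T : topologicalType) (S : set T) : set T :=
  closure S `\` interior S.

Definition components (T : topologicalType) (S : set T) : set (set T) :=
  connected_component S @` S.

Definition cube (R : realType) (d : nat) (l : R) : set 'rV[R]_d :=
  [set x | forall i, 0 <= x ord0 i <= l].
Arguments cube {R} d l.

(* Main.v *)
(* Suppose the sets [A n] had asymptotic dimension less than d - 1: for r = 5 they
   are covered by at most d - 1 families ("colours") of 5-disjoint D-bounded sets.
   Take n with [b n > D + 4] and consider the (sheared) tube of half-width [b n]
   around the segment from x to y; it lies in the cube, and its two ends avoid
   [A n].  Colour the points of a fine grid in the tube by the colour of a nearby
   point of [A n], with one more colour for the points far from [A n].  By the
   d-dimensional Hex theorem some colour joins a pair of opposite faces.  For the
   extra colour this connects x to y outside [A n]; for a colour of the cover it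
   gives a D-bounded set of diameter at least [b n - 4].

   The Hex theorem is proved with cup products modulo 2 on the torus (Z/(n+2))^d:
   each colour defines a closed 1-cochain dual to a coordinate hypersurface,
   the product of these cochains integrates to 1, and if no colour joined its two
   faces, then at each vertex the cochain of its colour would vanish nearby. *)

Require Import Defs.
From mathcomp Require Import all_boot all_order all_algebra.
From mathcomp Require Import zify ring lra.

Set Implicit Arguments.
Unset Strict Implicit.
Unset Printing Implicit Defensive.

Import Order.TTheory GRing.Theory Num.Theory.
Local Open Scope ring_scope.

(** * Cup products modulo 2 on the discrete torus *)

Section TorusCup.
Context {d n : nat}.
Notation point := {ffun 'I_d -> 'I_n.+2}.

Definition unit_step (i : 'I_d) : point := [ffun j => (j == i)%:R].

Lemma unit_stepE (v : point) i j : (v + unit_step i) j = v j + (j == i)%:R.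
Proof. by rewrite !ffunE. Qed.

(** The cocycle condition on the square at [v] in directions [i] and [j]; modulo 2 no signs
    arise. *)
Definition closed_cochain (a : point -> 'I_d -> 'F_2) := forall v i j,
  a v i + a (v + unit_step i) j = a v j + a (v + unit_step j) i.

(* The iterated cup product of the 1-cochains [a k], k in s, on the cube with
   lowest vertex v and edge directions J; it is 0 unless #|J| = size s. *)
Fixpoint cup (a : 'I_d -> point -> 'I_d -> 'F_2) (s : seq 'I_d)
    (J : {set 'I_d}) (v : point) : 'F_2 :=
  if s is k :: s' then
    \sum_(i in J) a k v i * cup a s' (J :\ i) (v + unit_step i)
  else (J == set0)%:R.

Lemma addF2 (x : 'F_2) : x + x = 0.
Proof. by rewrite -mulr2n -mulr_natr (_ : 2%:R = 0) ?mulr0//; apply/val_inj. Qed.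

Lemma eqF2 (x y : 'F_2) : x + y = 0 -> x = y.
Proof. by move=> h; rewrite -[x]addr0 -(addF2 y) addrA h add0r. Qed.

Lemma sum_symF2 (K : {set 'I_d}) (f : 'I_d -> 'I_d -> 'F_2) :
    (forall i j, i \in K -> j \in K -> i != j -> f i j = f j i) ->
  \sum_(i in K) \sum_(j in K :\ i) f i j = 0.
Proof.
move=> fC.
rewrite (eq_bigr (fun i : 'I_d => \sum_(j in K | (j < i)%N) f i j +
    \sum_(j in K | (i < j)%N) f i j)); last first.
  move=> i iK; rewrite (bigID (fun j : 'I_d => (j < i)%N)) /=.
  congr (_ + _); apply: eq_bigl => j; rewrite !inE -val_eqE /=; case: ltngtP;
    by rewrite ?andbT ?andbF.
rewrite big_split /= [X in _ + X](exchange_big_dep (fun j => j \in K)) /=;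
  last by move=> ? ? _ /andP[].
rewrite -big_split /=; apply: big1 => i iK; apply: eqF2; rewrite addr0 iK /=.
rewrite [X in _ + X](eq_bigr (fun j => f i j)) ?addF2//.
by move=> j /andP[jK lt]; apply: fC => //; rewrite -val_eqE neq_ltn lt.
Qed.

(** A Leibniz rule: products of closed cochains are closed. The two sides sum the product over the
    facets of the cube away from [v] and through [v]. *)
Lemma cup_closed a s : (forall k, closed_cochain (a k)) ->
    forall (K : {set 'I_d}) (v : point),
  \sum_(i in K) cup a s (K :\ i) (v + unit_step i) =
  \sum_(i in K) cup a s (K :\ i) v.
Proof.
move=> ac; elim: s => [|k s IH] K v //=.
apply: eqF2; rewrite -big_split /=.
have -> : \sum_(i in K) (\sum_(j in K :\ i)
      a k (v + unit_step i) j * cup a s (K :\ i :\ j) (v + unit_step i + unit_step j)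
    + \sum_(j in K :\ i) a k v j * cup a s (K :\ i :\ j) (v + unit_step j)) =
  \sum_(i in K) \sum_(j in K :\ i) (a k (v + unit_step i) j + a k v j) *
    cup a s (K :\ i :\ j) (v + unit_step i + unit_step j).
  have dep : forall i j, (i \in K) && (j \in K :\ i) = (j \in K) && (i \in K :\ j).
    move=> i j; rewrite !inE eq_sym.
    by case: (i \in K); case: (j \in K); rewrite ?andbT ?andbF.
  rewrite big_split /= [X in _ + X](exchange_big_dep (fun j => j \in K)) /=; last first.
    by move=> i j _; rewrite !inE => /andP[].
  (* The induction hypothesis on [K :\ j] moves the later factors to the far corner of the square in
     directions [i] and [j]. *)
  have -> : \sum_(j in K) \sum_(i in K | j \in K :\ i)
       a k v j * cup a s (K :\ i :\ j) (v + unit_step j) =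
     \sum_(j in K) \sum_(i in K | j \in K :\ i)
       a k v j * cup a s (K :\ i :\ j) (v + unit_step i + unit_step j).
    apply: eq_bigr => j jK.
    under eq_bigl => i do rewrite dep jK /=.
    under [RHS]eq_bigl => i do rewrite dep jK /=.
    rewrite -!mulr_sumr; congr (_ * _).
    under eq_bigr => i _ do rewrite setDDl setUC -setDDl.
    under [RHS]eq_bigr => i _ do rewrite setDDl setUC -setDDl addrAC.
    by rewrite IH.
  rewrite [X in _ + X](exchange_big_dep (fun j => j \in K)) /=;
    last by move=> ? ? _ /andP[].
  rewrite -big_split /=; apply: eq_bigr => i iK.
  rewrite [X in _ + X](eq_bigl (fun j => j \in K :\ i)); last first.
    by move=> j; rewrite iK !inE /=; case: (j \in K); rewrite ?andbF.
  by rewrite -big_split /=; apply: eq_bigr => j _; rewrite mulrDl.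
(* Closedness of [a k] makes the bracket symmetric in [i] and [j], and modulo 2 symmetric terms
   cancel in pairs. *)
apply: sum_symF2 => i j iK jK ij.
rewrite setDDl setUC -setDDl addrAC; congr (_ * _); apply: eqF2.
rewrite [X in _ + X]addrC addrACA [X in X + _]addrC ac addF2 //.
Qed.

(* The coboundary of u, plus the cocycle that generates the cohomology of the
   k-th circle: it detects the edge from -1 to 0. *)
Definition wrap_cochain (u : point -> 'F_2) (k : 'I_d) (v : point) (j : 'I_d) :
    'F_2 :=
  u (v + unit_step j) + u v + ((j == k) && (v k == - 1))%:R.

Lemma wrap_cochain_closed u k : closed_cochain (wrap_cochain u k).
Proof.
have cancel (x y z : 'F_2) : (x + y) + (z + x) = y + z.
  by rewrite [x + y]addrC addrACA addF2 addr0.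
move=> v i j; rewrite /wrap_cochain !unit_stepE [LHS]addrACA [RHS]addrACA.
rewrite !cancel; congr (_ + _).
  by rewrite addrAC.
by case: (eqVneq i k) => _; case: (eqVneq j k) => _ //=; rewrite !(addr0, add0r).
Qed.

(** Each factor is cohomologous to the generator of its circle, so the product integrates like the
    fundamental class of the subtorus in the directions [s], whatever [u] is. *)
Lemma cup_total u s : uniq s ->
  \sum_(v : point | [forall j, (j \notin s) ==> (v j == 0)])
    cup (fun k => wrap_cochain (u k) k) s [set j in s] v = 1.
Proof.
elim: s => [_|k s IH /= /andP[ks us]] /=.
  rewrite (big_pred1 (0 : point)) => [|v].
    by rewrite (_ : [set j in [::]] == set0) //; apply/eqP/setP => j; rewrite !inE.
  apply/forallP/eqP => [h|-> j]; last by rewrite ffunE eqxx.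
  by apply/ffunP => j; rewrite ffunE; apply/eqP; have := h j.
rewrite -[RHS](IH us).
set J := [set j in k :: s]; pose a l := wrap_cochain (u l) l; rewrite -/a.
have ac l : closed_cochain (a l) by exact: wrap_cochain_closed.
have JE : J :\ k = [set j in s].
  by apply/setP => j; rewrite !inE; case: eqVneq => [->|] //=; rewrite (negbTE ks).
pose P (v : point) := [forall j, (j \notin k :: s) ==> (v j == 0)].
have PS (v : point) i : i \in J -> P (v + unit_step i) = P v.
  move=> iJ; apply: eq_forallb => j; rewrite unit_stepE.
  case: (eqVneq j i) => [->|]; last by rewrite addr0.
  by move: iJ; rewrite inE => ->.
have shift i (F : point -> 'F_2) : i \in J ->
    \sum_(v | P v) F (v + unit_step i) = \sum_(v | P v) F v.
  move=> iJ; rewrite [RHS](reindex (fun v : point => v + unit_step i)) /=.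
    by apply: eq_bigl => v; rewrite PS.
  by exists (fun v : point => v - unit_step i) => v _; rewrite ?addrK ?subrK.
(* Up to an exact term, which vanishes on the torus, only the wrap part of the
   first cochain contributes, and it restricts the sum to the slice [v k = 0]. *)
have -> : \sum_(v | P v) \sum_(i in J)
     a k v i * cup a s (J :\ i) (v + unit_step i) =
   \sum_(v | P v) \sum_(i in J) (u k (v + unit_step i) * cup a s (J :\ i) (v + unit_step i)
     + u k v * cup a s (J :\ i) v
     + ((i == k) && (v k == - 1))%:R * cup a s (J :\ i) (v + unit_step i)).
  apply: eq_bigr => v _; rewrite /a /wrap_cochain -/a.
  rewrite (eq_bigr (fun i => u k (v + unit_step i) * cup a s (J :\ i) (v + unit_step i)
     + u k v * cup a s (J :\ i) (v + unit_step i)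
     + ((i == k) && (v k == - 1))%:R * cup a s (J :\ i) (v + unit_step i))); last first.
    by move=> i _; rewrite !mulrDl.
  by rewrite !big_split /= -!mulr_sumr cup_closed.
rewrite exchange_big /=.
have kJ : k \in J by rewrite inE mem_head.
under eq_bigr => i iJ.
  rewrite !big_split /= (shift i (fun v : point => u k v * cup a s (J :\ i) v)) //.
  rewrite addF2 add0r.
  over.
rewrite (bigD1 k) //= [X in _ + X]big1 ?addr0; last first.
  by move=> i /andP[_ /negbTE ik]; apply: big1 => v _; rewrite ik mul0r.
transitivity (\sum_(v | P v) (v k == 0)%:R * cup a s [set j in s] v).
  rewrite -(shift k (fun w : point => (w k == 0)%:R * cup a s [set j in s] w)) //.
  by rewrite JE; apply: eq_bigr => v _; rewrite !unit_stepE !eqxx /= addr_eq0.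
rewrite [RHS]big_mkcond /= [LHS]big_mkcond /=; apply: eq_bigr => v _.
have -> : [forall j, (j \notin s) ==> (v j == 0)] = P v && (v k == 0).
  apply/forallP/andP => [h|[/forallP h vk] j].
    split; last by have := h k; rewrite ks.
    apply/forallP => j; have := h j; rewrite inE negb_or.
    by case: (j \in s); case: (v j == 0); rewrite ?andbF ?implybT.
  by have := h j; rewrite inE negb_or; case: (eqVneq j k) => [->|] //=; rewrite vk implybT.
by case: (P v) => //=; case: (v k == 0); rewrite ?mul1r ?mul0r.
Qed.

(** Each term of the expanded product follows an edge path in the cube, and its factor [a k] starts
    at a corner [p] where direction [j] has not been used yet. *)
Lemma cup_vanish a s k : k \in s -> forall (J : {set 'I_d}) (v : point),
    (forall (p : point) j, j \in J -> p j = v j ->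
      (forall l, l \in J -> p l = v l \/ p l = v l + 1) ->
      (forall l, l \notin J -> p l = v l) -> a k p j = 0) ->
  cup a s J v = 0.
Proof.
elim: s => // k' s IH; rewrite inE => /predU1P[<-|ks] J v h /=; apply: big1 => i iJ.
  by rewrite h ?mul0r //; left.
rewrite IH ?mulr0 // => p j; rewrite !inE => /andP[ji jJ].
rewrite unit_stepE (negbTE ji) addr0.
move=> pj hin hout; apply: h => // l lJ.
  case: (eqVneq l i) (hin l) (hout l) => [-> _|li + _]; rewrite !inE.
    by rewrite unit_stepE eqxx => ->; [right|].
  by rewrite li lJ unit_stepE (negbTE li) addr0; apply.
rewrite hout ?unit_stepE; last by rewrite !inE (negbTE lJ) andbF.
by case: eqVneq lJ => [->|]; rewrite ?iJ ?addr0.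
Qed.
End TorusCup.

(* The Hex theorem *)
From mathcomp Require Import all_classical.

(* [S i] stands for the vertices of colour i joined to the face [v i = 0] by a
   monochromatic chain of king moves; only this closure property is needed, so
   no paths appear. *)
Lemma hex_theorem (d n : nat) (c : {ffun 'I_d -> 'I_n.+1} -> 'I_d)
    (S : 'I_d -> {ffun 'I_d -> 'I_n.+1} -> Prop) :
    (forall v : {ffun 'I_d -> 'I_n.+1}, v (c v) = ord0 -> S (c v) v) ->
    (forall v w : {ffun 'I_d -> 'I_n.+1}, c w = c v ->
      (forall l, (v l <= (w l).+1)%N && (w l <= (v l).+1)%N) ->
      S (c v) v -> S (c v) w) ->
  exists v : {ffun 'I_d -> 'I_n.+1}, S (c v) v /\ v (c v) = ord_max.
Proof.
move=> S0 Sadj; apply: contrapT => noex.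
pose point := {ffun 'I_d -> 'I_n.+2}.
(* A grid vertex [v] is read as a unit cube of the torus, and [near v p] says that [p] is one of its
   corners. *)
pose near (v : {ffun 'I_d -> 'I_n.+1}) (p : point) :=
  [forall l, (v l <= p l)%N && (p l <= (v l).+1)%N].
(* [u k] marks the region reached in colour [k]: it is 1 on the face at 0 and, by [noex], 0 on the
   face at -1, the extra last tick. *)
pose u (k : 'I_d) (p : point) : 'F_2 := ((p k == 0) ||
  [exists v, [&& c v == k, `[< S k v >] & near v p]])%:R.
have valN1 : \val (- 1 : 'I_n.+2) = n.+1 by rewrite /= !modn_small // subn1.
have valS (x : 'I_n.+2) : x != - 1 -> \val (x + 1) = x.+1.
  move=> xN1; rewrite /= [(1 %% _)%N]modn_small // modn_small ?addn1 //.
  by move: xN1 (ltn_ord x); rewrite -val_eqE valN1 /=; lia.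
have u1 k (p : point) : p k = 0 -> u k p = 1 by rewrite /u => ->; rewrite eqxx.
have u0 k (p : point) : p k = - 1 -> u k p = 0.
  move=> pk; rewrite /u pk oppr_eq0 oner_eq0 /=.
  case: existsP => // -[v /and3P[/eqP cv /asboolP Sv /forallP/(_ k)]].
  rewrite pk valN1 => /andP[_ nv]; exfalso; apply: noex; exists v; rewrite cv; split=> //.
  by apply: ord_inj; apply/eqP; rewrite eqn_leq -ltnS ltn_ord /= -ltnS nv.
(* Cubes sharing a corner are king-move neighbours, so a cube that does not wrap has all its corners
   inside the region of its own colour, or all outside. *)
have ucst (v p : point) (r := [ffun l => inord (v l)]) :
    (forall l, v l != - 1) -> (forall l, p l = v l \/ p l = v l + 1) ->
    u (c r) p = `[< S (c r) r >]%:R.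
  move=> vN1 vp.
  have rE l : r l = v l :> nat.
    rewrite ffunE inordK //; move: (vN1 l) (ltn_ord (v l)).
    by rewrite -val_eqE valN1 /=; lia.
  have pE l : (r l <= p l)%N && (p l <= (r l).+1)%N.
    rewrite rE; case: (vp l) => ->; first by lia.
    by have /= -> := valS _ (vN1 l); lia.
  rewrite /u; congr (nat_of_bool _)%:R; apply/idP/asboolP => [/orP[/eqP pk|]|Sr].
  - apply: S0; apply: ord_inj; rewrite rE /=; have := pE (c r); rewrite pk rE /=.
    by lia.
  - case/existsP => w /and3P[/eqP cw /asboolP Sw /forallP nw].
    rewrite -cw; apply: Sadj; rewrite ?cw // => l.
    have /andP[wp pw] := nw l; have /andP[rp pr] := pE l.
    by rewrite (leq_trans wp pr) (leq_trans rp pw).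
  - by apply/orP; right; apply/existsP; exists r; rewrite eqxx /=; apply/andP; split;
      [apply/asboolP | apply/forallP].
have := cup_total u (enum_uniq 'I_d); rewrite big1 => [/eqP|v _].
  by rewrite eq_sym oner_eq0.
have JT : [set j in enum 'I_d] = [set: 'I_d] by apply/setP => j; rewrite !inE mem_enum.
(* On a cube wrapping in direction [k], the cochain of [k] vanishes: the jump of [u k] from 0 to 1
   cancels the wrap term. *)
have [/existsP[k /eqP vk]|/existsPn vN1] := boolP [exists k, v k == - 1].
  apply: (@cup_vanish _ _ _ _ k); first by rewrite mem_enum.
  rewrite JT => p j _ pj pin _; rewrite /wrap_cochain.
  case: (eqVneq j k) => [jk|jk] /=.
    move: pj; rewrite jk vk => pk.
    by rewrite u1 ?unit_stepE ?pk ?eqxx ?addNr // u0 //= addr0 addF2.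
  rewrite addr0; have pk : (p + unit_step j) k = p k.
    by rewrite unit_stepE eq_sym (negbTE jk) addr0.
  by have [e|e] := pin k (finset.in_setT k); [rewrite !u0 | rewrite !u1];
    rewrite ?pk ?e ?vk ?addNr // addF2.
(* Otherwise the cube is that of the vertex [r], and the cochain of its colour has neither a jump
   nor a wrap term here. *)
pose r : {ffun 'I_d -> 'I_n.+1} := [ffun l => inord (v l)].
apply: (@cup_vanish _ _ _ _ (c r)); first by rewrite mem_enum.
rewrite JT => p j _ pj pin _; rewrite /wrap_cochain.
have pin' l : p l = v l \/ p l = v l + 1 := pin l (finset.in_setT l).
rewrite (ucst v p) // (ucst v) // => [|l].
  rewrite addF2 add0r; case: (eqVneq j (c r)) => //= <-.
  by rewrite pj (negbTE (vN1 j)).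
by rewrite unit_stepE; case: (eqVneq l j) => [->|_]; [right; rewrite pj | rewrite addr0].
Qed.

(* Segments and distances in the cube *)
From mathcomp Require Import all_reals all_analysis.
Import numFieldNormedType.Exports.
Local Open Scope classical_set_scope.

Lemma mdist_row_leP (R : realType) (d : nat) (x y : 'rV[R]_d) (e : R) :
  0 <= e -> (mdist x y <= e) <-> (forall i, `|x ord0 i - y ord0 i| <= e).
Proof.
move=> e0; rewrite mdist_rowE; split=> [/bigmax_leP[_ h] i|h]; first exact: h.
by apply/bigmax_leP; split.
Qed.

Lemma coord_le_mdist (R : realType) (d : nat) (x y : 'rV[R]_d) i :
  `|x ord0 i - y ord0 i| <= mdist x y.
Proof. exact: (mdist_row_leP x y (mdist_ge0 x y)).1. Qed.

Lemma segment_component (R : realType) (d : nat) (S : set 'rV[R]_d)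
    (z p q : 'rV[R]_d) :
    connected_component S z p ->
    (forall t, 0 <= t <= 1 -> S (p + t *: (q - p))) ->
  connected_component S z q.
Proof.
move=> zp seg; apply: (connected_component_trans zp).
pose f (t : R) := p + t *: (q - p).
exists (f @` `[0, 1]) => /=; last first.
  by exists 1; [rewrite /= in_itv /= ler01 lexx | rewrite /f scale1r addrC subrK].
split.
- by exists 0; [rewrite /= in_itv /= ler01 lexx | rewrite /f scale0r addr0].
- by move=> _ [t tI <-]; apply: seg; move: tI; rewrite /= in_itv.
- apply: connected_continuous_connected; first exact: segment_connected.
  apply: continuous_subspaceT => t; apply: cvgD; first exact: cvg_cst.
  by apply: cvgZr_tmp; exact: cvg_id.
Qed.

(** The segment stays in the convex cube and within [mdist p q] of [p], so it cannot meet [A]. *)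
Lemma component_step (R : realType) (d : nat) (l : R) (A : set 'rV[R]_d)
    (z p q : 'rV[R]_d) :
    connected_component (cube d l `\` A) z p -> cube d l p -> cube d l q ->
    (forall a, A a -> mdist p q < mdist p a) ->
  connected_component (cube d l `\` A) z q.
Proof.
move=> zp Cp Cq far; apply: (segment_component zp) => t /andP[t0 t1]; split.
  move=> i; rewrite !mxE; move: (Cp i) (Cq i) => /andP[p0 pl] /andP[q0 ql].
  apply/andP; split; nra.
move=> /far; apply/negP; rewrite -leNgt; apply/mdist_row_leP => [|i]; first exact: mdist_ge0.
rewrite (le_trans _ (coord_le_mdist p q i)) // !mxE.
rewrite opprD addrA subrr add0r normrN normrM ger0_norm // -distrC.
by rewrite ler_piMl.
Qed.

(** Replacing one coordinate of [x] by 0 or [l] gives a boundary point whose distance to [x] is at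
    most the change in that coordinate. *)
Lemma edist_inf_cube (R : realType) (d : nat) (l b : R) (A : set 'rV[R]_d)
    (x : 'rV[R]_d) :
    cube d l x -> (b%:E < edist_inf (A `|` boundary (cube d l)) x)%E ->
  (forall a, A a -> b < mdist x a) /\ (forall i, b < x ord0 i < l - b).
Proof.
move=> Cx far.
have farP a : (A `|` boundary (cube d l)) a -> b < mdist x a.
  move=> Ba; rewrite -lte_fin -edist_mdist; apply: lt_le_trans far _.
  by apply: ereal_inf_lbound; exists a.
split=> [a Aa|i]; first by apply: farP; left.
pose z (t : R) : 'rV[R]_d := \row_j (if j == i then t else x ord0 j).
have dz t : mdist x (z t) <= `|x ord0 i - t|.
  apply/mdist_row_leP => // j; rewrite mxE; case: eqP => [->//|_].
  by rewrite subrr normr0.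
have l0 : 0 <= l by case/andP: (Cx i) => /le_trans; apply.
have bz t : 0 <= t <= l ->
    (forall e, 0 < e -> exists2 s, `|t - s| < e & ~~ (0 <= s <= l)) ->
    b < `|x ord0 i - t|.
  move=> tI out; apply: lt_le_trans (dz t); apply: farP; right; split.
    by apply: subset_closure => j; rewrite mxE; case: eqP.
  rewrite /interior -nbhs_ballE => -[e /= e0]; rewrite ballEmdist => sub.
  have [s se] := out e e0; move/negP; apply.
  have : cube d l (z s).
    apply: sub => /=; apply: le_lt_trans se; apply/mdist_row_leP => // j.
    by rewrite !mxE; case: eqP => // _; rewrite subrr normr0.
  by move/(_ i); rewrite mxE eqxx.
case/andP: (Cx i) => xi0 xil.
apply/andP; split.
  rewrite -[X in _ < X]ger0_norm // -[X in `|X|]subr0; apply: bz; first by rewrite lexx.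
  move=> e e0; exists (- (e / 2)); last by rewrite negb_and -ltNge oppr_lt0 divr_gt0.
  by rewrite sub0r opprK gtr0_norm ?divr_gt0 // ltr_pdivrMr // mulr_natr mulr2n ltrDl.
rewrite ltrBrDr -ltrBrDl -[X in _ < X]ger0_norm ?subr_ge0 // distrC.
apply: bz; first by rewrite lexx l0.
move=> e e0; exists (l + e / 2); last by rewrite negb_and -!ltNge ltrDl divr_gt0 // orbT.
rewrite opprD addrA subrr sub0r normrN gtr0_norm ?divr_gt0 //.
by rewrite ltr_pdivrMr // mulr_natr mulr2n ltrDl.
Qed.

Lemma mdist_set_dist (R : realType) (X : metricType R) (V W : set X) (r : R) v w :
  (r%:E <= set_dist V W)%E -> V v -> W w -> r <= mdist v w.
Proof.
move=> rVW Vv Ww; rewrite -lee_fin -edist_mdist; apply: le_trans rVW _.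
by apply: ereal_inf_lbound; exists (v, w).
Qed.

Lemma mdist_diam (R : realType) (X : metricType R) (V : set X) (r : R) v w :
  (diam V <= r%:E)%E -> V v -> V w -> mdist v w <= r.
Proof.
move=> Vr Vv Vw; rewrite -lee_fin -edist_mdist; apply: le_trans Vr.
by apply: ereal_sup_ubound; exists (v, w).
Qed.

Lemma mdist_lt_chain (R : realType) (X : metricType R) (a p q a' : X) (r s t : R) :
  mdist p a < r -> mdist p q <= s -> mdist q a' < t -> mdist a a' < r + s + t.
Proof.
rewrite metric_sym => ap pq qa'; apply: le_lt_trans (metric_triangle _ p _) _.
rewrite -addrA ltrD //; apply: le_lt_trans (metric_triangle _ q _) _.
by rewrite ler_ltD.
Qed.

(** * The sheared tube *)

Section Tube.
Context {R : realType} {d : nat} (x y : 'rV[R]_d) (i0 : 'I_d) (b : R) (n : nat).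
Hypotheses (b_ge0 : 0 <= b) (n_big : mdist x y + 2 * b < n%:R).
Hypothesis i0_max : forall i, `|y ord0 i - x ord0 i| <= `|y ord0 i0 - x ord0 i0|.

Let n_gt0 : 0 < n%:R :> R.
Proof. by apply: le_lt_trans n_big; rewrite addr_ge0 ?mdist_ge0 ?mulr_ge0. Qed.

Definition tick (j : 'I_n.+1) : R := j%:R / n%:R.

(* The tube is sheared: it is only widened in the coordinates other than i0, the
   one in which y - x is largest, so that its sides stay b apart. *)
Definition offset (w : {ffun 'I_d -> 'I_n.+1}) (i : 'I_d) : R :=
  if i == i0 then 0 else (2 * tick (w i) - 1) * b.

Definition tube (w : {ffun 'I_d -> 'I_n.+1}) : 'rV[R]_d :=
  \row_i (x ord0 i + tick (w i0) * (y ord0 i - x ord0 i) + offset w i).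

Lemma tick_itv j : 0 <= tick j <= 1.
Proof.
rewrite divr_ge0 ?ler0n //= ler_pdivrMr // mul1r ler_nat.
by rewrite -ltnS.
Qed.

Lemma tick0 : tick ord0 = 0. Proof. by rewrite /tick mul0r. Qed.

Lemma tick_max : tick ord_max = 1. Proof. by rewrite /tick divff // gt_eqF. Qed.

Lemma tick_adj (j k : 'I_n.+1) : (j <= k.+1)%N && (k <= j.+1)%N ->
  `|tick j - tick k| <= n%:R^-1.
Proof.
move=> /andP[jk kj]; rewrite -mulrBl normrM [`|n%:R^-1|]gtr0_norm ?invr_gt0 //.
rewrite ler_piMl ?invr_ge0 // ler_norml; move: jk kj.
by rewrite -!(ler_nat R) -!natr1; lra.
Qed.

Lemma offset_le w i : `|offset w i| <= b.
Proof.
rewrite /offset; case: eqP => _; first by rewrite normr0.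
rewrite normrM (ger0_norm b_ge0) ler_piMl // ler_norml.
by have := tick_itv (w i); lra.
Qed.

(** A step of one tick moves a coordinate by at most [(mdist x y + 2 * b) / n], which [n_big] keeps
    below 1. *)
Lemma tube_adj (v w : {ffun 'I_d -> 'I_n.+1}) :
    (forall i, (v i <= (w i).+1)%N && (w i <= (v i).+1)%N) ->
  mdist (tube v) (tube w) <= 1.
Proof.
move=> adj; apply/mdist_row_leP => // i; rewrite !mxE.
have -> : x ord0 i + tick (v i0) * (y ord0 i - x ord0 i) + offset v i -
   (x ord0 i + tick (w i0) * (y ord0 i - x ord0 i) + offset w i) =
   (tick (v i0) - tick (w i0)) * (y ord0 i - x ord0 i) + (offset v i - offset w i).
  by ring.
have le1 : `|(tick (v i0) - tick (w i0)) * (y ord0 i - x ord0 i)| <= n%:R^-1 * mdist x y.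
  by rewrite normrM ler_pM ?tick_adj // distrC coord_le_mdist.
have le2 : `|offset v i - offset w i| <= n%:R^-1 * (2 * b).
  rewrite /offset; case: eqP => _.
    by rewrite subrr normr0 mulr_ge0 ?invr_ge0 ?mulr_ge0.
  have -> : (2 * tick (v i) - 1) * b - (2 * tick (w i) - 1) * b =
     (tick (v i) - tick (w i)) * (2 * b) by ring.
  by rewrite normrM [`|2 * b|]ger0_norm ?mulr_ge0 // ler_wpM2r ?mulr_ge0 // tick_adj.
apply: le_trans (ler_normD _ _) _; apply: le_trans (lerD le1 le2) _.
by rewrite -mulrDr mulrC ler_pdivrMr // mul1r ltW.
Qed.

Lemma tube_start (w : {ffun 'I_d -> 'I_n.+1}) : w i0 = ord0 -> mdist x (tube w) <= b.
Proof.
move=> w0; apply/mdist_row_leP => // i; rewrite mxE w0 tick0 mul0r addr0.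
by rewrite opprD addrA subrr sub0r normrN offset_le.
Qed.

Lemma tube_end (w : {ffun 'I_d -> 'I_n.+1}) : w i0 = ord_max -> mdist y (tube w) <= b.
Proof.
move=> w1; apply/mdist_row_leP => // i; rewrite mxE w1 tick_max mul1r.
by rewrite addrC [x _ _ + _]addrC subrK opprD addrAC addNr sub0r normrN offset_le.
Qed.

Lemma tube_cube l w : (forall i, b < x ord0 i < l - b) ->
  (forall i, b < y ord0 i < l - b) -> cube d l (tube w).
Proof.
move=> xin yin i; rewrite mxE.
have /andP[t0 t1] := tick_itv (w i0); have := offset_le w i.
rewrite ler_norml => /andP[s0 s1].
move: (tick _) t0 t1 (offset _ _) s0 s1 => t t0 t1 s s0 s1.
move: (xin i) (yin i) => /andP[x0 x1] /andP[y0 y1].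
apply/andP; split; nra.
Qed.

(** The offsets differ by [2 * b] in coordinate [i]. The drift along [y - x] that could compensate
    is at least as large in coordinate [i0], so one of the two coordinates differs by [b] or
    more. *)
Lemma tube_wide (v w : {ffun 'I_d -> 'I_n.+1}) i :
  i != i0 -> v i = ord0 -> w i = ord_max ->
  b <= mdist (tube v) (tube w).
Proof.
move=> ii0 vi wi.
have := coord_le_mdist (tube v) (tube w) i; have := coord_le_mdist (tube v) (tube w) i0.
rewrite !mxE /offset eqxx (negbTE ii0) vi wi tick0 tick_max !addr0.
set tv := tick _; set tw := tick _.
have -> : x ord0 i0 + tv * (y ord0 i0 - x ord0 i0) -
  (x ord0 i0 + tw * (y ord0 i0 - x ord0 i0)) = (tv - tw) * (y ord0 i0 - x ord0 i0) by ring.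
have -> : x ord0 i + tv * (y ord0 i - x ord0 i) + (2 * 0 - 1) * b -
  (x ord0 i + tw * (y ord0 i - x ord0 i) + (2 * 1 - 1) * b) =
  (tv - tw) * (y ord0 i - x ord0 i) - 2 * b by ring.
rewrite normrM => le0 lei.
have : `|(tv - tw) * (y ord0 i - x ord0 i)| <= `|tv - tw| * `|y ord0 i0 - x ord0 i0|.
  by rewrite normrM ler_wpM2l.
by move: lei; rewrite !ler_norml => /andP[? ?] /andP[? ?]; lra.
Qed.
End Tube.

(** * From coarse covers to connected components *)

Lemma component_of_coarse_cover (R : realType) (d m : nat) (l b D : R)
    (A : set 'rV[R]_d.+1) (x y : 'rV[R]_d.+1) (U : 'I_m -> set (set (set_type A))) :
    (m <= d)%N -> 0 <= b -> D + 4 < b ->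
    (forall i, b < x ord0 i < l - b) -> (forall i, b < y ord0 i < l - b) ->
    (forall a, A a -> b < mdist x a) -> (forall a, A a -> b < mdist y a) ->
    cover (\bigcup_k U k) id = setT -> r_bounded D (\bigcup_k U k) ->
    (forall k, r_disjoint 5 (U k)) ->
  connected_component (cube d.+1 l `\` A) x y.
Proof.
move=> md b0 Db xin yin xA yA Ucov Ubd Udisj; apply: contrapT => ncomp.
pose i0 := [arg max_(i > ord0) `|y ord0 i - x ord0 i|]%O.
have i0_max i : `|y ord0 i - x ord0 i| <= `|y ord0 i0 - x ord0 i0|.
  by rewrite /i0; case: arg_maxP => // j _ /(_ i); apply.
have [n n_big] : exists n, mdist x y + 2 * b < n%:R.
  exists (Num.bound (mdist x y + 2 * b)).
  by rewrite archi_boundP // addr_ge0 ?mdist_ge0 ?mulr_ge0.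
pose T := @tube R d.+1 x y i0 b n.
have TC w : cube d.+1 l (T w) by exact: tube_cube.
(* Direction [i0] is reserved for points far from [A]; [md] leaves room for every family among the
   others. *)
pose colour (k : 'I_m) := lift i0 (widen_ord md k).
have colour_inj : injective colour by move=> k k' /lift_inj/(congr1 val) /= /ord_inj.
have Ninj (k : 'I_m) : colour k != i0 by rewrite eq_sym neq_lift.
pose P w q := (q = i0 /\ forall a, A a -> 2 <= mdist (T w) a) \/
  exists k V (a : A), [/\ q = colour k, U k V, V a & mdist (T w) (\val a) < 2].
have /choice[c cP] : forall w, exists q, P w q.
  move=> w; have [[a [Aa wa]]|far] := pselect (exists a, A a /\ mdist (T w) a < 2); last first.
    exists i0; left; split=> // a Aa; rewrite leNgt; apply/negP => lt.
    by apply: far; exists a.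
  have : [set: A] (SigSub (mem_set Aa)) by [].
  rewrite -Ucov => -[V [k _ kV] Va].
  by exists (colour k); right; exists k, V, (SigSub (mem_set Aa)).
(* For a colour other than [i0], a chain is remembered by one set [V] of the family that comes near
   both [T w] and a point of the starting face. *)
pose S q w := (q = i0 /\ connected_component (cube d.+1 l `\` A) x (T w)) \/
  exists k V (a a0 : A) w0, [/\ q = colour k, U k V, V a, V a0 &
    [/\ mdist (T w) (\val a) < 2, mdist (T w0) (\val a0) < 2 & w0 q = ord0]].
have xS : (cube d.+1 l `\` A) x.
  split=> [i|/xA]; last by rewrite mdistxx; lra.
  by have := xin i; lra.
have yS : (cube d.+1 l `\` A) y.
  split=> [i|/yA]; last by rewrite mdistxx; lra.
  by have := yin i; lra.
have [||w [Sw wmax]] := @hex_theorem d.+1 n c S.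
- move=> w w0; case: (cP w) => [[cw _]|[k [V [a [cw UV Va wa]]]]]; rewrite cw in w0 *.
    left; split=> //; apply: (component_step (connected_component_refl xS)) => //.
      by case: xS.
    by move=> a /xA; apply: le_lt_trans; apply: tube_start.
  by right; exists k, V, a, a, w; split.
- move=> v w cwv adj Sv; have vw1 : mdist (T v) (T w) <= 1 by exact: tube_adj.
  case: Sv => [[cv xv]|[k [V [a [a0 [w0 [cv UV Va Va0 [va wa0 w00]]]]]]]].
    case: (cP v) => [[_ vA]|[k [V [a [cv' _ _ _]]]]]; last first.
      by have := Ninj k; rewrite -cv' cv eqxx.
    left; split=> //; apply: (component_step xv) => // a /vA.
    by apply: lt_le_trans; apply: le_lt_trans vw1 _; rewrite ltr1n.
  case: (cP w) => [[cw _]|[k' [V' [a' [cw UV' Va' wa']]]]].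
    by have := Ninj k; rewrite -cv -cwv cw eqxx.
  have kk' : k' = k by apply: colour_inj; rewrite -cw -cv.
  rewrite {k'}kk' in UV' cw *.
  (* Otherwise two sets of one family would be closer than 2 + 1 + 2 = 5: two approximations and one
     grid step. *)
  have VV' : V = V'.
    apply: contrapT => /(Udisj k _ _ UV UV') /mdist_set_dist /(_ Va Va').
    apply/negP; rewrite -ltNge.
    have := mdist_lt_chain va vw1 wa'.
    by have -> : 2 + 1 + 2 = 5 :> R by ring.
  by right; exists k, V', a', a0, w0; split=> //; rewrite -VV'.
case: Sw => [[cw xw]|[k [V [a [a0 [w0 [cw UV Va Va0 [wa wa0 w00]]]]]]]].
  apply: ncomp; apply: connected_component_trans xw _.
  apply: connected_component_sym.
  apply: (component_step (connected_component_refl yS)) => //; first by case: yS.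
  by move=> a /yA; apply: le_lt_trans; apply: tube_end => //; rewrite -cw.
(* [V] now reaches across the tube, so [b] is less than 2 + D + 2, against [Db]. *)
have wide : b <= mdist (T w0) (T w).
  by apply: (@tube_wide _ _ _ _ _ _ _ _ _ _ _ _ (c w)) => //; rewrite cw.
have a0a : mdist (\val a0) (\val a) <= D.
  by apply: (mdist_diam (V := V)) => //; apply: Ubd; exists k.
rewrite metric_sym in wa; rewrite metric_sym in wa0.
have := mdist_lt_chain wa0 a0a wa.
by lra.
Qed.

Theorem theorem1p4 (R : realType) (d : nat) (d_ge1 : (1 <= d)%N)
    (L b : nat -> R)
    (L_gt0 : forall n, 0 < L n) (b_gt0 : forall n, 0 < b n)
    (L_infty : L n @[n --> \oo] --> +oo) (b_infty : b n @[n --> \oo] --> +oo)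
    (A : nat -> set 'rV[R]_d)
    (A_sub : forall n, A n `<=` cube d (L n))
    (A_separates : forall n, exists K K',
      [/\ components (cube d (L n) `\` A n) K,
          components (cube d (L n) `\` A n) K' & K <> K'])
    (A_far : forall n, exists x y : 'rV[R]_d,
      [/\ cube d (L n) x, cube d (L n) y,
          exists K K', [/\ components (cube d (L n) `\` A n) K,
            components (cube d (L n) `\` A n) K', K <> K', K x & K' y],
          ((b n)%:E < edist_inf (A n `|` boundary (cube d (L n))) x)%E &
          ((b n)%:E < edist_inf (A n `|` boundary (cube d (L n))) y)%E]) :
  ((d%:R - 1)%:E <= asdim (fun n => set_type (A n) : metricType R))%E.
Proof.
rewrite /asdim; case: pselect => [ex_n|_]; last by rewrite leey.
case: ex_minnP => m /asboolP[D Dctl] _.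
case: d d_ge1 A A_sub A_separates A_far ex_n D Dctl => // d _ A _ _ A_far _ D Dctl.
(* An [m]-dimensional control function gives [m.+1] families, so [m < d] fits them into the [d]
   directions other than [i0]. *)
rewrite lee_fin -natr1 addrK ler_nat leqNgt; apply/negP => md.
pose r : {nonneg R} := NngNum (ler0n R 5).
have r_gt0 : 0 < r%:num by rewrite /= ltr0n.
have [n bn] : exists n, (D r)%:num + 4 < b n.
  have /cvgryPgt/(_ ((D r)%:num + 4)) [n _ /(_ n)] := b_infty.
  by move=> /(_ (leqnn n)) bn; exists n.
have [U [Ucov Ubd Udisj]] := Dctl _ r_gt0 n.
have [x [y [Cx Cy [K [K' [[z Sz <-] [z' Sz' <-] KK' zx z'y]]] /(edist_inf_cube Cx)[xA xin]
  /(edist_inf_cube Cy)[yA yin]]]] := A_far n.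
apply: KK'.
have xy := component_of_coarse_cover md (ltW (b_gt0 n)) bn xin yin xA yA Ucov Ubd Udisj.
rewrite (same_connected_component zx) (same_connected_component z'y).
exact: same_connected_component xy.
Qed.
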